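(* Let $\mathbf{M}_0,\dots,\mathbf{M}_k$ be HPD matrices. The following are equivalent: (1) $\{\mathbf{M}_j\}_{j=0}^{k}$ is a set of sequentially dominated matrices; (2) $\beta(\mathbf{M}_j,\mathbf{M}_{j-1})<\infty$ for all $j=1,\dots,k$.
   Context: An infinite Hermitian matrix $\mathbf{M}=(c_{i,j})_{i,j=0}^{\infty}$ is HPD (Hermitian positive definite) if all its finite truncated sections are positive definite. $c_{00}$ is the space of complex sequences (row vectors) with finitely many nonzero entries; for infinite Hermitian matrices, $\mathbf{B}\le\mathbf{A}$ means $v\mathbf{B}v^*\le v\mathbf{A}v^*$ for every $v\in c_{00}$. A set $\{\mathbf{M}_j\}_{j=0}^k$ is sequentially dominated if there is a constant $C>0$ such that $\mathbf{M}_j\le C\mathbf{M}_{j-1}$ for every $j=1,\dots,k$. For infinite HPD matrices $\mathbf{A},\mathbf{B}$ let $\mathbf{A}_n,\mathbf{B}_n$ be their truncated sections of size $(n+1)\times(n+1)$, and let $\beta_n(\mathbf{A}_n,\mathbf{B}_n)$ be the largest generalized eigenvalue of $\mathbf{A}_n$ with respect to $\mathbf{B}_n$, i.e. the largest real $\lambda$ for which $\mathbf{A}_nv=\lambda\mathbf{B}_nv$ for some nonzero vector $v$. Then $\beta(\mathbf{A},\mathbf{B})=\lim_{n\to\infty}\beta_n(\mathbf{A}_n,\mathbf{B}_n)\in[0,\infty]$. *)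

(* Defs.v *)
From HB Require Import structures.
From mathcomp Require Import all_boot all_order all_algebra.
From mathcomp Require Import finmap.
From mathcomp Require Import complex.
From mathcomp Require Import all_classical all_reals all_analysis.
Set Implicit Arguments.
Unset Strict Implicit.
Unset Printing Implicit Defensive.
Import Order.TTheory GRing.Theory Num.Theory.
Import numFieldNormedType.Exports.
Local Open Scope classical_set_scope.
Local Open Scope ring_scope.
Local Open Scope complex_scope.
Local Open Scope sesquilinear_scope.

Definition infmx (R : realType) := nat -> nat -> R[i].

Definition infmx_scale (R : realType) (c : R) (M : infmx R) : infmx R :=
  fun i j => c%:C * M i j.

Definition infmx_hermitian (R : realType) (M : infmx R) : Prop :=
  forall i j, M i j = Num.conj (M j i).

Definition trunc_mx (R : realType) (M : infmx R) (n : nat) : 'M[R[i]]_n.+1 :=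
  \matrix_(i < n.+1, j < n.+1) M i j.

(* In the order of R[i], 0 < z says that z is real and positive. *)
Definition posdefmx (R : realType) (n : nat) (A : 'M[R[i]]_n) : Prop :=
  A \is hermsymmx /\
  forall v : 'rV[R[i]]_n, v != 0 -> 0 < (v *m A *m v^t*) 0 0.

Definition hpd (R : realType) (M : infmx R) : Prop :=
  infmx_hermitian M /\ forall n, posdefmx (trunc_mx M n).

Definition c00 (R : realType) := {fsfun nat -> R[i] with 0}.

(* v M v^*; the entries of v vanish outside finsupp v. *)
Definition quad_form (R : realType) (M : infmx R) (v : c00 R) : R[i] :=
  \sum_(i <- finsupp v) \sum_(j <- finsupp v) v i * M i j * Num.conj (v j).

(* Both sides are real when A and B are Hermitian, so that <= on R[i] is then
   the comparison of real numbers. *)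
Definition infmx_le (R : realType) (B A : infmx R) : Prop :=
  forall v : c00 R, quad_form B v <= quad_form A v.

Definition sequentially_dominated (R : realType) (k : nat)
    (M : 'I_k.+1 -> infmx R) : Prop :=
  exists2 C : R, 0 < C &
    forall i j : 'I_k.+1, j = i.+1 :> nat ->
      infmx_le (M j) (infmx_scale C (M i)).

Definition gen_eigenvalue (R : realType) (n : nat) (A B : 'M[R[i]]_n)
    (l : R) : Prop :=
  exists2 v : 'cV[R[i]]_n, v != 0 & A *m v = l%:C *: (B *m v).

Definition largest_gen_eigenvalue (R : realType) (n : nat)
    (A B : 'M[R[i]]_n) (l : R) : Prop :=
  gen_eigenvalue A B l /\ forall m : R, gen_eigenvalue A B m -> m <= l.

(* The default value 0 is only used when no largest generalized eigenvalue
   exists; there is always one when n > 0 and A, B are positive definite. *)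
Definition beta_n (R : realType) (n : nat) (A B : 'M[R[i]]_n) : R :=
  xget 0 [set l | largest_gen_eigenvalue A B l].

Definition beta (R : realType) (A B : infmx R) : \bar R :=
  limn (fun n => (beta_n (trunc_mx A n) (trunc_mx B n))%:E).

(* Main.v *)
(** If B is positive definite and A is Hermitian, a congruence T turns B into
the identity and A into a real diagonal matrix. The largest generalized
eigenvalue of A with respect to B is then the largest diagonal entry, i.e. the
maximum of the Rayleigh quotient v A v^* / v B v^*. Hence beta_n is
the best constant c with A <= c B on the vectors of c00 supported in [0, n]; it
is nondecreasing in n, so its limit is its supremum, which is finite exactly
when a single c works on all of c00. *)
Require Import Defs.
From mathcomp Require Import all_boot all_order all_algebra.
From mathcomp Require Import complex.
From mathcomp Require Import all_classical all_reals all_analysis.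
From mathcomp Require Import finmap.
Set Implicit Arguments.
Unset Strict Implicit.
Unset Printing Implicit Defensive.
Import Order.TTheory GRing.Theory Num.Theory.
Local Open Scope classical_set_scope.
Local Open Scope ring_scope.
Local Open Scope complex_scope.
Local Open Scope sesquilinear_scope.

(** * Hermitian forms of finite matrices *)

Definition hform (C : numClosedFieldType) n (A : 'M[C]_n) (v : 'rV[C]_n) : C :=
  (v *m A *m v^t*) 0 0.

Lemma hformE (C : numClosedFieldType) n (A : 'M[C]_n) (v : 'rV[C]_n) :
  hform A v = \sum_i \sum_j v 0 i * A i j * Num.conj (v 0 j).
Proof.
rewrite /hform mxE exchange_big /=; apply: eq_bigr => j _.
by rewrite !mxE mulr_suml.
Qed.

Lemma trmxC_mul (C : numClosedFieldType) m n p
    (A : 'M[C]_(m, n)) (B : 'M[C]_(n, p)) : (A *m B)^t* = B^t* *m A^t*.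
Proof. by rewrite trmx_mul map_mxM. Qed.

Lemma hform_mul (C : numClosedFieldType) n (A T : 'M[C]_n) (v : 'rV[C]_n) :
  hform A (v *m T) = hform (T *m A *m T^t*) v.
Proof. by rewrite /hform trmxC_mul !mulmxA. Qed.

Lemma hform_diag (C : numClosedFieldType) n (d v : 'rV[C]_n) :
  hform (diag_mx d) v = \sum_i d 0 i * `|v 0 i| ^+ 2.
Proof.
rewrite hformE; apply: eq_bigr => i _.
rewrite (bigD1 i) //= big1 => [|j ji].
  by rewrite mxE eqxx mulr1n addr0 normCK mulrAC mulrC.
by rewrite mxE eq_sym (negPf ji) mulr0 mul0r.
Qed.

Lemma hermsymmx_trmxC (C : numClosedFieldType) n (A : 'M[C]_n) :
  A \is hermsymmx -> A^t* = A.
Proof.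
by move=> /is_hermitianmxP; rewrite expr0 scale1r => {2}->.
Qed.

Lemma hermsymmx_conj (C : numClosedFieldType) n (A T : 'M[C]_n) :
  A \is hermsymmx -> T *m A *m T^t* \is hermsymmx.
Proof.
move=> hA; apply/is_hermitianmxP; rewrite expr0 scale1r.
by rewrite !trmxC_mul trmxCK (hermsymmx_trmxC hA) mulmxA.
Qed.

(** * Diagonalization by congruence *)

Lemma hermsymmx_spectral (R : rcfType) n (A : 'M[R[i]]_n) :
  A \is hermsymmx -> exists2 U : 'M[R[i]]_n, U \is unitarymx &
  exists a : 'I_n -> R, U *m A *m U^t* = diag_mx (\row_i (a i)%:C).
Proof.
move=> hA; exists (spectralmx A); first exact: spectral_unitarymx.
exists (fun i => complex.Re (spectral_diag A 0 i)).
have -> : \row_i (complex.Re (spectral_diag A 0 i))%:C = spectral_diag A.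
  apply/rowP => i; rewrite mxE RRe_real //.
  by have /mxOverP := hermitian_spectral_diag_real hA.
have /orthomx_spectralP hS := hermitian_normalmx hA.
have Uu := spectral_unit A.
rewrite {2}hS -invmx_unitary ?spectral_unitarymx //.
by rewrite !mulmxA mulmxV // mul1mx mulmxK.
Qed.

(** A unitary congruence makes [B] diagonal with positive entries; a diagonal rescaling then turns
    these entries into 1. *)
Lemma posdefmx_congruent_id (R : realType) n (B : 'M[R[i]]_n) :
  posdefmx B -> exists2 S : 'M[R[i]]_n, S \in unitmx & S *m B *m S^t* = 1%:M.
Proof.
move=> [hB pB]; have [U hU [b hb]] := hermsymmx_spectral hB.
have Uu := unitarymx_unit hU.
(* [b i] is the value of the form of [B] at row [i] of [U], which is nonzero because [U] is
   invertible. *)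
have b_gt0 i : 0 < b i.
  have di0 : (delta_mx 0 i : 'rV[R[i]]_n) != 0.
    by apply/eqP => /matrixP/(_ 0 i)/eqP; rewrite !mxE !eqxx oner_eq0.
  have /pB : (delta_mx 0 i : 'rV[R[i]]_n) *m U != 0.
    apply: contraNneq di0 => /(congr1 (mulmx^~ (invmx U))).
    by rewrite mulmxK // mul0mx => ->.
  rewrite -/(hform _ _) hform_mul hb hform_diag (bigD1 i) //= big1 => [|j ji].
    by rewrite !mxE !eqxx normr1 expr1n mulr1 addr0 ltcR.
  by rewrite !mxE (negPf ji) andbF normr0 expr0n mulr0.
(* The factor enters twice, once conjugated; being real, it contributes its square, the inverse of
   [b i]. *)
pose s := \row_i ((Num.sqrt (b i))^-1)%:C : 'rV[R[i]]_n.
have s_neq0 i : s 0 i != 0.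
  by rewrite mxE fmorph_eq0 invr_eq0 gt_eqF // sqrtr_gt0.
exists (diag_mx s *m U).
  rewrite unitmx_mul Uu andbT unitmxE det_diag unitfE.
  by apply/prodf_neq0 => i _.
rewrite trmxC_mul !mulmxA -(mulmxA _ U) -(mulmxA _ (U *m B)) hb.
rewrite tr_diag_mx map_diag_mx !mulmx_diag -diag_const_mx.
congr diag_mx; apply/rowP => i; rewrite !mxE.
rewrite [X in _ * X](conjc_real (Num.sqrt (b i))^-1) -!rmorphM /= mulrAC -invfM -expr2.
by rewrite sqr_sqrtr ?ltW // mulVf ?gt_eqF.
Qed.

(** Once [S] has normalized [B], a unitary [U] diagonalizes the transformed [A] and leaves the
    identity unchanged. *)
Lemma simultaneous_diag (R : realType) n (A B : 'M[R[i]]_n) :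
  A \is hermsymmx -> posdefmx B ->
  exists2 T : 'M[R[i]]_n, T \in unitmx &
  T *m B *m T^t* = 1%:M /\
  exists a : 'I_n -> R, T *m A *m T^t* = diag_mx (\row_i (a i)%:C).
Proof.
move=> hA /posdefmx_congruent_id[S Su hS].
have [U hU [a ha]] := hermsymmx_spectral (hermsymmx_conj S hA).
exists (U *m S); first by rewrite unitmx_mul (unitarymx_unit hU).
split; last by exists a; rewrite trmxC_mul -ha !mulmxA.
rewrite trmxC_mul -[RHS](unitarymxP hU) !mulmxA.
by rewrite -(mulmxA _ S) -(mulmxA _ (S *m B)) hS mulmx1.
Qed.

(** * Generalized eigenvalues and the Rayleigh quotient *)

Lemma gen_eigenvalue_hform (R : realType) n (A B : 'M[R[i]]_n) l :
  gen_eigenvalue A B l -> exists2 v : 'rV[R[i]]_n, v != 0 &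
    hform A v = l%:C * hform B v.
Proof.
move=> [v v0 hv]; exists (v^t*).
  by apply: contra_neq v0 => h; rewrite -(trmxCK v) h trmx0 map_mx0.
by rewrite /hform trmxCK -!mulmxA hv -scalemxAr mxE.
Qed.

(** In the coordinates given by [T], the quotient of the two forms is a weighted mean of the [a i],
    so the largest of them bounds it. *)
Lemma largest_gen_eigenvalue_hform (R : realType) n (A B : 'M[R[i]]_n.+1) :
  A \is hermsymmx -> posdefmx B ->
  exists2 l : R, largest_gen_eigenvalue A B l &
    forall v, hform A v <= l%:C * hform B v.
Proof.
move=> hA hB; have [T Tu [hTB [a hTA]]] := simultaneous_diag hA hB.
case: (@Order.TotalTheory.arg_maxP _ _ _ ord0 xpredT a isT) => k _ kmax.
have ray v : hform A v <= (a k)%:C * hform B v.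
  (* Write [v] as [w *m T] and compare the two sums of squares term by term. *)
  rewrite -(mulmxKV Tu v); move: (v *m invmx T) => w.
  rewrite !hform_mul hTA hTB -diag_const_mx !hform_diag mulr_sumr.
  apply: ler_sum => i _; rewrite !mxE mul1r ler_wpM2r ?exprn_ge0 //.
  by rewrite lecR; exact: kmax.
have Tsu : T^t* \in unitmx by rewrite map_unitmx unitmx_tr.
exists (a k) => //; split=> [|m /gen_eigenvalue_hform[v v0 hv]].
  (* An eigenvector for [a k] is column [k] of [T^t*]; the equation is checked after multiplying by
     [T], where both matrices are diagonal. *)
  exists (T^t* *m delta_mx k (0 : 'I_1)).
    apply/eqP => /(congr1 (mulmx (invmx (T^t*)))).
    rewrite mulKmx // mulmx0 => /matrixP/(_ k 0)/eqP.
    by rewrite !mxE !eqxx oner_eq0.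
  apply: (can_inj (mulKmx Tu)).
  rewrite -scalemxAr !mulmxA hTA hTB mul1mx.
  apply/matrixP => i j; rewrite mul_diag_mx !mxE.
  by case: eqP => [->|_] //=; rewrite !mulr0.
have Bv : 0 < hform B v by apply: hB.2.
by rewrite -lecR -(ler_pM2r Bv) -hv ray.
Qed.

(** The default value in [beta_n] is never reached here, since a largest generalized eigenvalue
    exists; it is unique by antisymmetry. *)
Lemma beta_n_hform (R : realType) n (A B : 'M[R[i]]_n.+1) :
  A \is hermsymmx -> posdefmx B ->
  largest_gen_eigenvalue A B (beta_n A B) /\
  forall v, hform A v <= (beta_n A B)%:C * hform B v.
Proof.
move=> hA hB; have [l hl ray] := largest_gen_eigenvalue_hform hA hB.
have hbeta : largest_gen_eigenvalue A B (beta_n A B).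
  by apply: (@xgetPex _ _ [set l | largest_gen_eigenvalue A B l]); exists l.
have -> : beta_n A B = l; last by [].
by apply/le_anti; rewrite hl.2 ?hbeta.2 //; [exact: hl.1|exact: hbeta.1].
Qed.

(** * Finitely supported sequences as row vectors *)

Definition row_c00 (R : realType) n (v : c00 R) : 'rV[R[i]]_n.+1 :=
  \row_i v i.

(** The cut at [n.+1] ensures that [inord] is only applied to indices in range. *)
Definition c00_row (R : realType) n (w : 'rV[R[i]]_n.+1) : c00 R :=
  [fsfun i in [fset j | j in iota 0 n.+1]%fset => w 0 (inord i)].

Lemma c00_row_out (R : realType) n (w : 'rV[R[i]]_n.+1) j :
  (n < j)%N -> c00_row w j = 0.
Proof.
by move=> nj; rewrite fsfunE in_fset (mem_iota 0) add0n ltnS leq0n leqNgt nj.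
Qed.

Lemma c00_rowK (R : realType) n : cancel (@c00_row R n) (@row_c00 R n).
Proof.
move=> w; apply/rowP => i; rewrite mxE fsfunE in_fset (mem_iota 0) add0n.
by rewrite ltn_ord inord_val.
Qed.

(** Indices up to [n] outside the support only add zeros, so a sum over the support becomes one over
    the fixed range of a matrix product. *)
Lemma sum_finsupp (R : realType) n (v : c00 R) (F : nat -> R[i]) :
  (forall j, (n < j)%N -> v j = 0) -> (forall j, v j = 0 -> F j = 0) ->
  \sum_(j <- finsupp v) F j = \sum_(j < n.+1) F j.
Proof.
move=> hv hF; rewrite -(big_mkord xpredT F) [RHS](bigID (mem (finsupp v))) /=.
rewrite [X in _ + X]big1 ?addr0 => [|j]; last first.
  by rewrite memNfinsupp => /eqP/hF.
rewrite -[RHS]big_filter; apply: perm_big; apply: uniq_perm => //.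
- exact: fset_uniq.
- exact/filter_uniq/iota_uniq.
move=> j; rewrite mem_filter mem_index_iota leq0n ltnS /=.
case: (leqP j n) => [_|/hv vj]; rewrite ?andbT ?andbF //.
by apply/negbTE; rewrite memNfinsupp vj.
Qed.

Lemma quad_form_trunc (R : realType) (M : infmx R) n (v : c00 R) :
  (forall j, (n < j)%N -> v j = 0) ->
  quad_form M v = hform (trunc_mx M n) (row_c00 n v).
Proof.
move=> hv; rewrite hformE /quad_form (@sum_finsupp _ n) //; last first.
  by move=> j vj; rewrite big1 // => i _; rewrite vj !mul0r.
apply: eq_bigr => i _; rewrite (@sum_finsupp _ n) //.
  by apply: eq_bigr => j _; rewrite !mxE.
by move=> j ->; rewrite rmorph0 mulr0.
Qed.

Lemma c00_bounded_support (R : realType) (v : c00 R) :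
  exists n, forall j, (n < j)%N -> v j = 0.
Proof.
exists (\max_(i <- finsupp v) i)%N => j; rewrite ltnNge => hj.
apply/eqP; rewrite -memNfinsupp; apply: contra hj => hj.
exact: leq_bigmax_seq.
Qed.

(** * The limit [beta] as the best domination constant *)

Lemma beta_n_rayleigh (R : realType) (A B : infmx R) n (v : c00 R) :
  hpd A -> hpd B -> (forall j, (n < j)%N -> v j = 0) ->
  quad_form A v <= (beta_n (trunc_mx A n) (trunc_mx B n))%:C * quad_form B v.
Proof.
move=> hA hB hv; rewrite !(quad_form_trunc _ hv).
exact: (beta_n_hform (hA.2 n).1 (hB.2 n)).2.
Qed.

Lemma beta_n_attained (R : realType) (A B : infmx R) n :
  hpd A -> hpd B -> exists v : c00 R,
  [/\ forall j, (n < j)%N -> v j = 0, 0 < quad_form B v &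
   quad_form A v = (beta_n (trunc_mx A n) (trunc_mx B n))%:C * quad_form B v].
Proof.
move=> hA hB; have [[hb _] _] := beta_n_hform (hA.2 n).1 (hB.2 n).
have [w w0 hw] := gen_eigenvalue_hform hb.
have hv := @c00_row_out _ _ w.
exists (c00_row w); rewrite !(quad_form_trunc _ hv) c00_rowK; split=> //.
exact: (hB.2 n).2.
Qed.

Lemma quad_form_scale (R : realType) (c : R) (M : infmx R) (v : c00 R) :
  quad_form (infmx_scale c M) v = c%:C * quad_form M v.
Proof.
rewrite /quad_form mulr_sumr; apply: eq_bigr => i _.
rewrite mulr_sumr; apply: eq_bigr => j _.
by rewrite /infmx_scale !mulrA (mulrC (v i)).
Qed.

Lemma beta_n_le (R : realType) (A B : infmx R) (c : R) n :
  hpd A -> hpd B -> infmx_le A (infmx_scale c B) ->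
  beta_n (trunc_mx A n) (trunc_mx B n) <= c.
Proof.
move=> hA hB hAB; have [v [_ Bv Av]] := beta_n_attained n hA hB.
by move: (hAB v); rewrite Av quad_form_scale (ler_pM2r Bv) lecR.
Qed.

(** A sequence attaining the bound for [m] is supported in [0, m], hence is also a test vector for
    [n]. *)
Lemma beta_n_nondecreasing (R : realType) (A B : infmx R) :
  hpd A -> hpd B ->
  {homo (fun n => beta_n (trunc_mx A n) (trunc_mx B n)) :
    m n / (m <= n)%N >-> m <= n}.
Proof.
move=> hA hB m n mn; have [v [hv Bv Av]] := beta_n_attained m hA hB.
rewrite -lecR -(ler_pM2r Bv) -Av; apply: beta_n_rayleigh => // j nj.
exact/hv/(leq_ltn_trans mn).
Qed.

Lemma quad_form_ge0 (R : realType) (B : infmx R) (v : c00 R) :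
  hpd B -> 0 <= quad_form B v.
Proof.
move=> hB; have [n hv] := c00_bounded_support v.
rewrite (quad_form_trunc _ hv).
have [->|v0] := eqVneq (row_c00 n v) 0; last exact/ltW/(hB.2 n).2.
by rewrite /hform !mul0mx mxE.
Qed.

Lemma betaE (R : realType) (A B : infmx R) : hpd A -> hpd B ->
  beta A B =
  ereal_sup (range (fun n => (beta_n (trunc_mx A n) (trunc_mx B n))%:E)).
Proof.
move=> hA hB; apply/cvg_lim => //; apply: ereal_nondecreasing_cvgn => m n mn.
by rewrite lee_fin; exact: beta_n_nondecreasing.
Qed.

Lemma beta_ltyP (R : realType) (A B : infmx R) : hpd A -> hpd B ->
  (beta A B < +oo)%E <-> exists c : R, infmx_le A (infmx_scale c B).
Proof.
move=> hA hB; rewrite (betaE hA hB); split=> [sup_lty|[c hc]]; last first.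
  apply: (@le_lt_trans _ _ c%:E); last exact: ltry.
  by apply: ge_ereal_sup => _ [n _ <-]; rewrite lee_fin; exact: beta_n_le.
set s := ereal_sup _ in sup_lty.
have le_s n : ((beta_n (trunc_mx A n) (trunc_mx B n))%:E <= s)%E.
  by apply: ereal_sup_ubound; exists n.
(* Besides being below [+oo], the supremum is at least its term of index 0, a real number. *)
have s_fin : s \is a fin_num.
  rewrite fin_numE (lt_eqF sup_lty) andbT gt_eqF //.
  by apply: lt_le_trans (le_s 0); exact: ltNyr.
(* The section size [n] depends on [v], but the supremum bounds every [beta_n] at once. *)
exists (fine s) => v; have [n hv] := c00_bounded_support v.
apply: (le_trans (beta_n_rayleigh hA hB hv)).
rewrite quad_form_scale ler_wpM2r ?quad_form_ge0 // lecR.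
by rewrite -lee_fin fineK.
Qed.

Lemma infmx_le_scale (R : realType) (A B : infmx R) (c d : R) :
  hpd B -> c <= d -> infmx_le A (infmx_scale c B) ->
  infmx_le A (infmx_scale d B).
Proof.
move=> hB cd hc v; apply: (le_trans (hc v)).
by rewrite !quad_form_scale ler_wpM2r ?quad_form_ge0 // lecR.
Qed.

Theorem proposition4 (R : realType) (k : nat) (M : 'I_k.+1 -> infmx R)
    (hM : forall j, hpd (M j)) :
  sequentially_dominated M <->
  (forall i j : 'I_k.+1, j = i.+1 :> nat -> (beta (M j) (M i) < +oo)%E).
Proof.
split=> [[c _ hc] i j ij|hbeta].
  by apply/(beta_ltyP (hM j) (hM i)); exists c; exact: hc.
(* One constant per pair of indices, with 0 for pairs that are not consecutive. *)
have /choice[c hc] (ij : 'I_k.+1 * 'I_k.+1) : exists c : R,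
    ij.2 = ij.1.+1 :> nat -> infmx_le (M ij.2) (infmx_scale c (M ij.1)).
  have [h|?] := pselect (ij.2 = ij.1.+1 :> nat); last by exists 0.
  by have /(beta_ltyP (hM _) (hM _))[c hc] := hbeta _ _ h; exists c.
(* The absolute values make the sum at least each [c ij], and the 1 makes the common constant
   positive. *)
exists (1 + \sum_ij `|c ij|).
  by rewrite ltr_pwDl // sumr_ge0.
move=> i j ij; apply: infmx_le_scale (hc (i, j) ij) => //.
rewrite (bigD1 (i, j)) //= addrCA (le_trans (ler_norm _)) // lerDl.
by rewrite addr_ge0 // sumr_ge0.
Qed.
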